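(* Let $A$ be a Banach algebra and $B$ a Banach $A$-bimodule. Then for every $n\ge 2$: (1) If $e^{(n)}\in A^{(n)}$ is a right unit for $B^{(n)}$ and $Z^\ell_{e^{(n)}}(B^{(n)})=B^{(n)}$, then $A^{(n-2)}B^{(n-1)}=B^{(n-1)}$. (2) If $e^{(n)}\in A^{(n)}$ is a left unit for $B^{(n)}$ and $Z^r_{e^{(n)}}(B^{(n)})=B^{(n)}$, then $B^{(n-1)}A^{(n-2)}=B^{(n-1)}$. (3) If $e^{(n)}\in A^{(n)}$ is a right unit for $B^{(n)}$ and $\tilde Z^\ell_{e^{(n)}}(B^{(n)})=B^{(n)}$, then $A^{(n-2)}B^{(n-1)}=B^{(n-1)}$ and the weak$^*$ closure of $A^{(n-2)}B^{(n+1)}$ is $B^{(n+1)}$. (4) If $e^{(n)}\in A^{(n)}$ is a left unit for $B^{(n)}$ and $\tilde Z^r_{e^{(n)}}(B^{(n)})=B^{(n)}$, then $B^{(n-1)}A^{(n-2)}=B^{(n-1)}$ and the weak$^*$ closure of $B^{(n+1)}A^{(n-2)}$ is $B^{(n+1)}$.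
   Context: $X^{(0)}=X$ and $X^{(k)}$ is the dual of $X^{(k-1)}$; $X^{(k)}$ is regarded as a subspace of $X^{(k+2)}$ canonically. For a bounded bilinear map $m:X\times Y\to Z$ define $m^*:Z^*\times X\to Y^*$, $m^{**}:Y^{**}\times Z^*\to X^*$, $m^{***}:X^{**}\times Y^{**}\to Z^{**}$ by $\langle m^*(z',x),y\rangle=\langle z',m(x,y)\rangle$, $\langle m^{**}(y'',z'),x\rangle=\langle y'',m^*(z',x)\rangle$, $\langle m^{***}(x'',y''),z'\rangle=\langle x'',m^{**}(y'',z')\rangle$; and $m^t(y,x)=m(x,y)$, $m^{t***}=(m^t)^{***}:Y^{**}\times X^{**}\to Z^{**}$. For every $k$, $A^{(k)}$ is regarded as a Banach algebra and $B^{(k)}$ as a Banach $A^{(k)}$-bimodule: passing from $k$ to $k+2$, the product of $A^{(k)}$ and the left and right module actions $\pi_\ell:A^{(k)}\times B^{(k)}\to B^{(k)}$, $\pi_r:B^{(k)}\times A^{(k)}\to B^{(k)}$ are replaced by their extensions $m^{***}$ (first Arens product and $\pi_\ell^{***},\pi_r^{***}$); all are written by juxtaposition. For even $k$ this starts from the given $A$ and $B$; for odd $k$ the product on $A^{(1)}$ and its actions on $B^{(1)}$ are taken as given. $B^{(k+1)}$ is the dual $A^{(k)}$-bimodule of $B^{(k)}$: $\langle b^{(k+1)}a,b\rangle=\langle b^{(k+1)},ab\rangle$, $\langle ab^{(k+1)},b\rangle=\langle b^{(k+1)},ba\rangle$ for $a\in A^{(k)}$, $b\in B^{(k)}$. In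 particular $A^{(n-2)}$ acts on $B^{(n-1)}$, and $A^{(n-2)}\subseteq A^{(n)}$ acts on $B^{(n+1)}$. $XY=\{xy:x\in X,y\in Y\}$. An element $e\in A^{(n)}$ is a right (resp. left) unit for $B^{(n)}$ if it is a right (resp. left) unit element of the algebra $A^{(n)}$ and $be=b$ (resp. $eb=b$) for all $b\in B^{(n)}$. Weak$^*$ on $X^{(k)}$ is $\sigma(X^{(k)},X^{(k-1)})$ and weak is $\sigma(X^{(k)},X^{(k+1)})$. A map $f$ on $A^{(n)}$ is weak$^*$-weak$^*$ (resp. weak$^*$-weak) point continuous at $e$ if $a_\alpha\to e$ weak$^*$ implies $f(a_\alpha)\to f(e)$ weak$^*$ (resp. weakly), for every net $(a_\alpha)$ in $A^{(n)}$. With $\pi_\ell$ the left action of $A^{(n-2)}$ on $B^{(n-2)}$, for $e\in A^{(n)}$: $Z^\ell_{e}(B^{(n)})$ is the set of $b\in B^{(n)}$ such that $a\mapsto ba$ is weak$^*$-weak$^*$ point continuous at $e$; $Z^r_{e}(B^{(n)})$ is the set of $b\in B^{(n)}$ such that $a\mapsto \pi_\ell^{t***}(b,a)$ is weak$^*$-weak$^*$ point continuous at $e$; $\tilde Z^\ell_{e}(B^{(n)})$ is the set of $b\in B^{(n)}$ such that $a\mapsto ba$ is weak$^*$-weak point continuous at $e$; $\tilde Z^r_{e}(B^{(n)})$ is the set of $b\in B^{(n)}$ such that $a\mapsto ab$ is weak$^*$-weak point continuous at $e$. *)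

(* Defs.v *)
From HB Require Import structures.
From mathcomp Require Import all_boot all_order all_algebra sesquilinear.
From mathcomp.real_closed Require Import complex.
From mathcomp Require Import boolp classical_sets functions reals.
From mathcomp Require Import topology normedtype.

Set Implicit Arguments.
Unset Strict Implicit.
Unset Printing Implicit Defensive.

Import Order.TTheory GRing.Theory Num.Theory.
Import numFieldTopology.Exports numFieldNormedType.Exports.

Local Open Scope classical_set_scope.
Local Open Scope ring_scope.

(* In [normedModType K] the norm takes its values in [K] itself, so operator
   norms are suprema in [K]; the mixin supplies them uniformly over R and C. *)
HB.mixin Record NumField_hasNonnegSup K & Num.NumField K := {
  nonneg_supremum : forall S : set K, S !=set0 -> (forall x, S x -> 0 <= x) ->
    ubound S !=set0 -> supremums S !=set0 }.

#[short(type="scalarFieldType")]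
HB.structure Definition ScalarField :=
  {K of Num.NumField K & NumField_hasNonnegSup K}.

Lemma real_nonneg_supremum (R : realType) (S : set R) : S !=set0 ->
  (forall x, S x -> 0 <= x) -> ubound S !=set0 -> supremums S !=set0.
Proof.
move=> S0 _ ubS; exists (sup S); split.
  by apply: sup_upper_bound; split.
by move=> y yS; apply: ge_sup.
Qed.

Lemma complex_nonneg_supremum (R : realType) (S : set R[i]) : S !=set0 ->
  (forall x, S x -> 0 <= x) -> ubound S !=set0 -> supremums S !=set0.
Proof.
move=> [x0 Sx0] Sge0 [M MS].
have ImS x : S x -> complex.Im x = 0.
  by move=> /Sge0; rewrite lecE => /andP[/eqP -> _].
pose T : set R := [set complex.Re x | x in S].
have supT : has_sup T.
  split; first by exists (complex.Re x0), x0.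
  exists (complex.Re M) => _ [x Sx <-].
  by have := MS _ Sx; rewrite lecE => /andP[].
exists ((sup T)%:C)%C; split.
  move=> x Sx; rewrite lecE /= ImS// eqxx /=.
  by apply: sup_upper_bound => //; exists x.
move=> y yS; have := yS _ Sx0; rewrite !lecE (ImS _ Sx0) /= => /andP[/eqP -> _].
rewrite eqxx /=; apply: ge_sup; first by exists (complex.Re x0), x0.
by move=> _ [x Sx <-]; have := yS _ Sx; rewrite lecE => /andP[].
Qed.

HB.instance Definition _ (R : realType) :=
  NumField_hasNonnegSup.Build (Real.sort R) (@real_nonneg_supremum R).
HB.instance Definition _ (R : realType) :=
  NumField_hasNonnegSup.Build (complex (Real.sort R))
    (@complex_nonneg_supremum R).

Variant scalars := RealScalars | ComplexScalars.

Definition scalar_field (R : realType) (s : scalars) : scalarFieldType :=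
  match s with RealScalars => R : scalarFieldType
             | ComplexScalars => R[i] : scalarFieldType end.

Section Dual.
Variables (K : scalarFieldType) (X : normedModType K).

Definition continuous_functional : {pred X -> K^o} :=
  mem [set f : X -> K^o | linear f /\ continuous f].

Record dual := Dual
  { dual_fun :> X -> K^o; dual_funP : dual_fun \in continuous_functional }.

HB.instance Definition _ := [isSub for dual_fun].
HB.instance Definition _ := [Choice of dual by <:].

Lemma continuous_functional_submod : submod_closed continuous_functional.
Proof.
split.
  by rewrite inE; split; [move=> a x y; rewrite scaler0 addr0|exact: cst_continuous].
move=> a f g; rewrite !inE => -[lf cf] [lg cg]; split.
  move=> b x y; rewrite /= !fctE lf lg !scalerDr !scalerA mulrC -!addrA.
  by congr (_ + _); rewrite !addrA; congr (_ + _); rewrite addrC.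
move=> x; apply: (@continuousD _ K^o) => //; last exact: cg.
by apply: (@continuousZr _ K^o); [exact: cf].
Qed.
HB.instance Definition _ := GRing.isSubmodClosed.Build _ _ _
  continuous_functional_submod.
HB.instance Definition _ := [SubChoice_isSubLmodule of dual by <:].

Lemma dual_linear (f : dual) : linear f.
Proof. by have := dual_funP f; rewrite inE => -[]. Qed.
HB.instance Definition _ (f : dual) :=
  GRing.isLinear.Build K X K^o *:%R (dual_fun f) (@dual_linear f).

Lemma dual_continuous (f : dual) : continuous f.
Proof. by have := dual_funP f; rewrite inE => -[]. Qed.

Lemma dual_ext (f g : dual) : f =1 g -> f = g.
Proof. by move=> fg; apply/val_inj/funext. Qed.

Lemma dualDE (f g : dual) x : (f + g) x = f x + g x. Proof. by []. Qed.
Lemma dualZE a (f : dual) x : (a *: f) x = a *: f x. Proof. by []. Qed.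

Lemma bounded_functional (f : X -> K^o) : linear f ->
  (exists M, forall x, `|f x| <= M * `|x|) -> f \in continuous_functional.
Proof.
move=> lf [M fM]; rewrite inE; split=> //.
pose F : {linear X -> K^o} :=
  HB.pack f (GRing.isLinear.Build K X K^o *:%R f lf).
apply: (@bounded_linear_continuous _ _ _ F); apply/linear_boundedP.
near=> r => x; have Mx := fM x.
have := le_trans (normr_ge0 _) Mx => Mx0.
rewrite (le_trans Mx)// -(ger0_norm Mx0) normrM normr_id ler_wpM2r//.
by near: r; apply: nbhs_pinfty_ge; rewrite normr_real.
Unshelve. all: by end_near. Qed.

Lemma dual_bounded (f : dual) : exists2 M, 0 <= M &
  forall x, `|f x| <= M * `|x|.
Proof.
have /linear_boundedP/pinfty_ex_gt0[M M0 fM] :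
    bounded_near f (nbhs (0 : X)).
  exact/linear_bounded_continuous/dual_continuous.
by exists M => //; exact: ltW.
Qed.

Definition dual_norm (f : dual) : K :=
  supremum 0 [set `|f x| | x in [set x : X | `|x| <= 1]].

Lemma dual_norm_supremums (f : dual) :
  supremums [set `|f x| | x in [set x : X | `|x| <= 1]] (dual_norm f).
Proof.
rewrite /dual_norm /supremum; set S := (X in supremums X).
have S0 : S !=set0 by exists `|f 0|, 0 => //=; rewrite normr0.
have /nonneg_supremum : S !=set0 by [].
case: ifPn => [/eqP SE|_]; first by case: S0 => y; rewrite /S SE.
move=> H; have [] : supremums S !=set0.
  apply: H; first by move=> _ [x _ <-].
  have [M M0 fM] := dual_bounded f.
  exists M => _ [x /= x1 <-]; rewrite (le_trans (fM x))//.
  by rewrite ler_piMr.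
by move=> y Sy; case: xgetP => // /(_ y).
Qed.

Lemma dual_norm_ge (f : dual) x : `|x| <= 1 -> `|f x| <= dual_norm f.
Proof. by move=> x1; have [+ _] := dual_norm_supremums f; apply; exists x. Qed.

Lemma dual_norm_ge0 (f : dual) : 0 <= dual_norm f.
Proof.
by rewrite (le_trans _ (@dual_norm_ge f 0 _))// normr0.
Qed.

Lemma dual_normP (f : dual) x : `|f x| <= dual_norm f * `|x|.
Proof.
have [->|x0] := eqVneq x 0; first by rewrite linear0 !normr0 mulr0.
have := @dual_norm_ge f (`|x|^-1 *: x).
rewrite linearZ/= !normrZ normfV normr_id mulVf ?normr_eq0// => /(_ (lexx _)).
by rewrite ler_pdivrMl ?normr_gt0// mulrC.
Qed.

Lemma dual_norm_le (f : dual) (M : K) : 0 <= M ->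
  (forall x, `|f x| <= M * `|x|) -> dual_norm f <= M.
Proof.
move=> M0 fM; have [_ ] := dual_norm_supremums f; apply => _ [x /= x1 <-].
by rewrite (le_trans (fM x))// ler_piMr.
Qed.

Lemma dual_normD (f g : dual) :
  dual_norm (f + g) <= dual_norm f + dual_norm g.
Proof.
apply: dual_norm_le; first by rewrite addr_ge0 ?dual_norm_ge0.
by move=> x; rewrite dualDE mulrDl (le_trans (ler_normD _ _))// lerD ?dual_normP.
Qed.

Lemma dual_normZ a (f : dual) : dual_norm (a *: f) = `|a| * dual_norm f.
Proof.
have le b g : dual_norm (b *: g) <= `|b| * dual_norm g.
  apply: dual_norm_le; first by rewrite mulr_ge0 ?dual_norm_ge0.
  by move=> x; rewrite dualZE normrZ -mulrA ler_wpM2l ?dual_normP.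
apply/eqP; rewrite eq_le le/=; have [->|a0] := eqVneq a 0.
  by rewrite normr0 mul0r dual_norm_ge0.
rewrite -ler_pdivlMl ?normr_gt0// -normfV (le_trans _ (le _ _))//.
by rewrite scalerA mulVf// scale1r.
Qed.

Lemma dual_norm_eq0 (f : dual) : dual_norm f = 0 -> f = 0.
Proof.
move=> f0; apply: dual_ext => x; apply/eqP; rewrite -normr_le0.
by rewrite (le_trans (dual_normP f x))// f0 mul0r.
Qed.

HB.instance Definition _ := Lmodule_isNormed.Build K dual
  dual_normD dual_normZ dual_norm_eq0.

Lemma dual_normE (f : dual) : `|f| = dual_norm f. Proof. by []. Qed.

Lemma ler_dual (f : dual) x : `|f x| <= `|f| * `|x|.
Proof. exact: dual_normP. Qed.

End Dual.


Section BoundedBilinear.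
Variable K : scalarFieldType.

Record bbilinear (X Y Z : normedModType K) := BBilinear {
  bbil_fun :> {bilinear X -> Y -> Z};
  bbil_bounded : exists M, forall x y, `|bbil_fun x y| <= M * `|x| * `|y| }.

Lemma bbilinear_bound (X Y Z : normedModType K) (m : bbilinear X Y Z) :
  exists2 M, 0 <= M & forall x y, `|m x y| <= M * `|x| * `|y|.
Proof.
have [M mM] := bbil_bounded m; exists `|M| => // x y.
have M0 := le_trans (normr_ge0 _) (mM x y).
by rewrite (le_trans (mM x y))// -(ger0_norm M0) !normrM !normr_id.
Qed.

Section Transpose.
Variables (X Y Z : normedModType K) (m : bbilinear X Y Z).

Definition bflip_fun (y : Y) (x : X) : Z := m x y.

Lemma bflip_linear : bilinear_for *:%R *:%R bflip_fun.
Proof. by split=> [x a u v|y a u v]; [exact: linearPr|exact: linearPl]. Qed.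
HB.instance Definition _ :=
  bilinear_isBilinear.Build K Y X Z *:%R *:%R bflip_fun bflip_linear.

Lemma bflip_bounded : exists M, forall (y : Y) (x : X),
  `|bflip_fun y x| <= M * `|y| * `|x|.
Proof.
by have [M mM] := bbil_bounded m; exists M => y x; rewrite mulrAC; exact: mM.
Qed.

(* m^t *)
Definition bflip : bbilinear Y X Z :=
  @BBilinear Y X Z bflip_fun bflip_bounded.

Lemma badj_functional (z' : dual Z) (x : X) :
  (fun y => z' (m x y)) \in @continuous_functional K Y.
Proof.
apply: bounded_functional.
  by move=> a u v; rewrite linearPr linearP.
have [M M0 mM] := bbilinear_bound m; exists (`|z'| * (M * `|x|)) => y.
by rewrite (le_trans (ler_dual _ _))// -mulrA ler_wpM2l.
Qed.

Definition badj_fun (z' : dual Z) (x : X) : dual Y := Dual (badj_functional z' x).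

Lemma badj_linear : bilinear_for *:%R *:%R badj_fun.
Proof.
split=> [x a f g|z' a u v]; apply: dual_ext => y //=.
by rewrite linearPl linearP.
Qed.
HB.instance Definition _ :=
  bilinear_isBilinear.Build K (dual Z) X (dual Y) *:%R *:%R badj_fun badj_linear.

Lemma badj_bounded : exists M, forall z' x,
  `|badj_fun z' x| <= M * `|z'| * `|x|.
Proof.
have [M M0 mM] := bbilinear_bound m; exists M => z' x.
apply: dual_norm_le; first by rewrite !mulr_ge0.
move=> y /=; rewrite (le_trans (ler_dual _ _))//.
by rewrite (mulrC M) -!mulrA ler_wpM2l// mulrA.
Qed.

(* m^* *)
Definition badj : bbilinear (dual Z) X (dual Y) :=
  @BBilinear (dual Z) X (dual Y) badj_fun badj_bounded.

End Transpose.

(* m^*** *)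
Definition arens_ext (X Y Z : normedModType K) (m : bbilinear X Y Z) :
  bbilinear (dual (dual X)) (dual (dual Y)) (dual (dual Z)) :=
  badj (badj (badj m)).

Lemma eval_functional (X : normedModType K) (x : X) :
  (fun f : dual X => f x) \in @continuous_functional K (dual X).
Proof.
apply: bounded_functional => //.
by exists `|x| => f; rewrite mulrC; exact: ler_dual.
Qed.

Definition canon_emb (X : normedModType K) (x : X) : dual (dual X) :=
  Dual (eval_functional x).

Fixpoint iter_dual (X : normedModType K) (k : nat) : normedModType K :=
  if k is k'.+1 then dual (iter_dual X k') else X.

(* sigma(X', X) is the topology of pointwise convergence on X, as a topology on
   an alias of [dual X]; [weak X] is sigma(X, X') on an alias of X. *)
Definition weak_star (X : normedModType K) : topologicalType :=
  initial_topology ((fun f x => f x) : dual X -> {ptws X -> K^o}).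

Definition weak_star_closure (X : normedModType K) (S : set (dual X)) :
  set (dual X) := @closure (weak_star X) S.

Definition weak (X : normedModType K) : topologicalType :=
  initial_topology ((fun x f => f x) : X -> {ptws dual X -> K^o}).

End BoundedBilinear.

Section Nets.

Definition directed (I : Type) (le : I -> I -> Prop) : Prop :=
  [/\ inhabited I, forall i, le i i,
      forall i j k, le i j -> le j k -> le i k
    & forall i j, exists2 k, le i k & le j k].

Definition net_filter (I : Type) (le : I -> I -> Prop) : set_system I :=
  [set P | exists i, forall j, le i j -> P j].

Definition net_continuous_at (S T : topologicalType) (f : S -> T) (e : S) :=
  forall (I : Type) (le : I -> I -> Prop) (u : I -> S), directed le ->
    u i @[i --> net_filter le] --> e ->
    f (u i) @[i --> net_filter le] --> f e.

End Nets.

Section Bimodules.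
Variable K : scalarFieldType.

(* No algebraic law is imposed here, so that the operations can be iterated;
   the laws are those of [banach_bimodule]. The actions are bounded, not
   necessarily contractive. *)
Record bimod_data (A B : normedModType K) := BimodData {
  amul : bbilinear A A A;
  lact : bbilinear A B B;
  ract : bbilinear B A B }.

Definition banach_algebra (A : normedModType K) (m : bbilinear A A A) : Prop :=
  associative m /\ (forall a b, `|m a b| <= `|a| * `|b|).

Definition banach_bimodule (A B : normedModType K) (D : bimod_data A B) : Prop :=
  [/\ banach_algebra (amul D),
      forall a1 a2 b, lact D (amul D a1 a2) b = lact D a1 (lact D a2 b),
      forall b a1 a2, ract D b (amul D a1 a2) = ract D (ract D b a1) a2
    & forall a1 b a2, lact D a1 (ract D b a2) = ract D (lact D a1 b) a2].

Definition arens_data (A B : normedModType K) (D : bimod_data A B) :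
    bimod_data (dual (dual A)) (dual (dual B)) :=
  BimodData (arens_ext (amul D)) (arens_ext (lact D)) (arens_ext (ract D)).

(* The structure of A^(k) and B^(k): the even levels start from that of A and
   B, the odd ones from a given structure [D1] on the first duals. *)
Fixpoint bimod_tower (A B : normedModType K) (D0 : bimod_data A B)
    (D1 : bimod_data (dual A) (dual B)) (k : nat) :
    bimod_data (iter_dual A k) (iter_dual B k) :=
  match k with
  | 0 => D0
  | 1 => D1
  | k'.+2 => arens_data (bimod_tower D0 D1 k')
  end.

(* <b' a, b> = <b', a b> *)
Definition dual_ract (A B : normedModType K) (D : bimod_data A B) :
  bbilinear (dual B) A (dual B) := badj (lact D).

(* <a b', b> = <b', b a> *)
Definition dual_lact (A B : normedModType K) (D : bimod_data A B) :
  bbilinear A (dual B) (dual B) := bflip (badj (bflip (ract D))).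

Definition right_unit (A B : normedModType K) (D : bimod_data A B) (e : A) :=
  (forall a, amul D a e = a) /\ (forall b, ract D b e = b).

Definition left_unit (A B : normedModType K) (D : bimod_data A B) (e : A) :=
  (forall a, amul D e a = a) /\ (forall b, lact D e b = b).

(* Here [D] is the structure of A^(n-2) and B^(n-2), so that [arens_data D] is
   that of A^(n) and B^(n). *)
Section TopologicalCenters.
Variables (A B : normedModType K) (D : bimod_data A B) (e : dual (dual A)).

Definition Zl : set (dual (dual B)) :=
  [set b | @net_continuous_at (weak_star (dual A)) (weak_star (dual B))
    (fun a => ract (arens_data D) b a) e].

Definition Zr : set (dual (dual B)) :=
  [set b | @net_continuous_at (weak_star (dual A)) (weak_star (dual B))
    (fun a => arens_ext (bflip (lact D)) b a) e].

Definition Zl_tilde : set (dual (dual B)) :=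
  [set b | @net_continuous_at (weak_star (dual A)) (weak (dual (dual B)))
    (fun a => ract (arens_data D) b a) e].

Definition Zr_tilde : set (dual (dual B)) :=
  [set b | @net_continuous_at (weak_star (dual A)) (weak (dual (dual B)))
    (fun a => lact (arens_data D) a b) e].

End TopologicalCenters.

End Bimodules.

(* Main.v *)
Require Import Defs.
From HB Require Import structures.
From mathcomp Require Import all_boot all_order all_algebra sesquilinear.
From mathcomp Require Import boolp classical_sets functions reals.
From mathcomp Require Import topology prodnormedzmodule normedtype.
From mathcomp.real_closed Require Import complex.

Import Order.TTheory GRing.Theory Num.Theory.
Import numFieldTopology.Exports numFieldNormedType.Exports.

Local Open Scope classical_set_scope.
Local Open Scope ring_scope.
Set Implicit Arguments.
Unset Strict Implicit.
Unset Printing Implicit Defensive.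

(** Put [A0 = A^(n-2)], [X = B^(n-1)] and let [e] be the unit in the bidual of
    [A0].  The theorem is a Cohen factorization on [X], with a bounded
    approximate identity that is extracted from [e].

    In the left-module case (1), the identity [a e = a] for [a] in [A0],
    evaluated at [f] in the dual of [A0], reads [e(b |-> f(a b)) = f a].  The
    analogue for the action is [e(b |-> psi(b x)) = psi x] for [psi] in [B^(n)],
    but [psi e = psi] pairs [e] and [psi] in the other order.  The continuity of
    [a |-> psi a] at [e] is what exchanges the two: along a net of elements [u]
    of [A0] that converges weak* to [e], both are limits of [psi(u x)]
    ([weak_star_continuous_eval]).  In the right-module case (2) the Arens
    extension of the left action has the right order from the start, and
    [e psi = psi], evaluated at [x], is the identity wanted.

    Those identities say that [(a, x)] lies in the weak closure of
    [{(a u, u x)}], [u] in the ball of radius [|e|].  Hahn-Banach improves this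
    to the norm closure, with [u] in the ball of radius [|e| + 1]: one
    functional dominated by a suitable gauge does the work of Goldstine's
    theorem and of Mazur's lemma ([weak_to_norm], [bounded_approximation]).

    The resulting approximate identity multiplies [A0] on the side opposite to
    the one on which it acts on [X]: a right approximate identity of [A0] acts
    on the left of [X].  Cohen's iteration still converges, because the factor
    close to the identity can be split off on the right of the operator to be
    inverted ([cohen_step], [cohen_factorization]).  The right-module case is
    the same lemma for the opposite algebra.

    For the density statements in (3) and (4), an element [u] of a net of [A0]
    converging weak* to [e] sends [xi] in [B^(n+1)] to [psi |-> xi(psi u)],
    respectively [psi |-> xi(u psi)].  The weak*-weak continuity at [e] makes
    this converge pointwise to [psi |-> xi(psi e)], respectively
    [psi |-> xi(e psi)], that is, to [xi] ([weak_star_closure_net]). *)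

(** * The Hahn-Banach theorem over the real and the complex numbers *)

Section RealHahnBanach.
Variables (R : realType) (V : lmodType R) (p : V -> R).
Hypothesis pD : forall x y, p (x + y) <= p x + p y.
Hypothesis pZ : forall (t : R) x, 0 <= t -> p (t *: x) = t * p x.

(** A linear functional on a subspace is encoded by its graph.  Closure under
    linear combinations and domination make it single-valued: if [(0, r)] is in
    [G] then so is [(0, - r)], and domination by [p] forces [r = 0]. *)
Definition subfunctional (G : set (V * R)) :=
  (forall t u v, G u -> G v -> G (t *: u + v)) /\
  (forall u, G u -> u.2 <= p u.1).

Let p0 : p 0 = 0.
Proof. by rewrite -(scale0r 0) pZ// mul0r. Qed.

Lemma line_subfunctional y :
  subfunctional [set u | exists t, u = t *: (y, p y)].
Proof.
split=> [t _ _ [a ->] [b ->]|_ [t ->] /=].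
  by exists (t * a + b); rewrite scalerDl scalerA.
have [t0|t0] := leP 0 t; first by rewrite pZ.
have := pD (t *: y) ((- t) *: y).
rewrite -scalerDl subrr scale0r p0 (@pZ (- t)); last by rewrite oppr_ge0 ltW.
by rewrite mulNr subr_ge0.
Qed.

Definition graph_span (G : set (V * R)) (v : V * R) : set (V * R) :=
  [set w | exists t u, G u /\ w = u + t *: v].

(** The value [c] at the new vector must lie above every [r - p (u - v)] and
    below every [p (u + v) - r], for [(u, r)] in [G]; sublinearity makes
    these compatible, so the supremum of the lower bounds is a valid choice. *)
Lemma subfunctional_extend (G : set (V * R)) (v : V) :
  subfunctional G -> G !=set0 ->
  exists c, subfunctional (graph_span G (v, c)).
Proof.
move=> [Glin Gp] [u0 Gu0].
have G0 : G 0 by have := Glin (-1) _ _ Gu0 Gu0; rewrite scaleN1r addNr.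
have GZ t u : G u -> G (t *: u).
  by move=> Gu; have := Glin t _ _ Gu G0; rewrite addr0.
pose S := [set u.2 - p (u.1 - v) | u in G].
have ubS : forall u, G u -> ubound S (p (u.1 + v) - u.2).
  move=> u Gu _ [w Gw <-]; rewrite lerBrDr -addrAC lerBlDr.
  have /Gp/= := Glin 1 _ _ Gw Gu; rewrite !scale1r.
  move=> /le_trans; apply.
  rewrite (_ : w.1 + u.1 = (u.1 + v) + (w.1 - v)) ?pD//.
  by rewrite addrC addrACA subrr addr0.
have supS : has_sup S.
  split; first by exists (u0.2 - p (u0.1 - v)), u0.
  by exists (p (u0.1 + v) - u0.2); exact: ubS.
exists (sup S); split.
  move=> t _ _ [a [u [Gu ->]]] [b [w [Gw ->]]].
  exists (t * a + b), (t *: u + w); split; first exact: Glin.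
  by rewrite scalerDr scalerA addrACA scalerDl.
move=> _ [t [u [Gu ->]]] /=; rewrite -[t *: sup S]/(t * sup S).
have [t0|t0|t0] := ltgtP t 0;
  last by rewrite t0 mul0r scale0r !addr0; exact: Gp.
- have : (((- t)^-1 *: u).2 - p (((- t)^-1 *: u).1 - v)) <= sup S.
    by apply: sup_upper_bound => //; exists ((- t)^-1 *: u) => //; exact: GZ.
  have t0' : 0 < - t by rewrite oppr_gt0.
  move=> /(ler_wpM2l (ltW t0')); rewrite mulrBr -(pZ _ (ltW t0'))/=.
  rewrite scalerBr !scalerA mulrA divff ?gt_eqF// scale1r mul1r.
  by rewrite scaleNr opprK mulNr lerBlDr [- _ + _]addrC lerBrDr.
- have : sup S <= p ((t^-1 *: u).1 + v) - (t^-1 *: u).2.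
    by apply: ge_sup; [exact: supS.1|apply: ubS; exact: GZ].
  move=> /(ler_wpM2l (ltW t0)); rewrite mulrBr -(pZ _ (ltW t0))/=.
  rewrite scalerDr !scalerA mulrA divff ?gt_eqF// scale1r mul1r.
  by rewrite lerBrDr addrC.
Qed.

(** Zorn's lemma is applied to the dominated graphs that contain the line
    through [(y, p y)].  The empty graph is admitted as well, since it is the
    union of the empty chain. *)
Lemma real_hahn_banach y : exists f : V -> R,
  [/\ forall t u v, f (t *: u + v) = t * f u + f v,
      forall v, f v <= p v & f y = p y].
Proof.
pose G0 := [set u : V * R | exists t, u = t *: (y, p y)].
pose P : set (set (V * R)) :=
  [set G | G !=set0 -> G0 `<=` G /\ subfunctional G].
have [G [PG Gmax]] : exists G, P G /\ forall B, G `<` B -> ~ P B.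
  apply: Zorn_bigcup => F FP Ftot [u [X FX Xu]].
  have FG Y w : F Y -> Y w -> G0 `<=` Y /\ subfunctional Y.
    by move=> FY Yw; apply: FP => //; exists w.
  split; first by move=> w /(FG _ _ FX Xu).1 Xw; exists X.
  split=> [t v w [Y FY Yv] [Z FZ Zw]|w [Y FY Yw]].
    have [YZ|ZY] := Ftot _ _ FY FZ.
      by exists Z => //; apply: (FG _ _ FZ Zw).2.1 => //; exact: YZ.
    by exists Y => //; apply: (FG _ _ FY Yv).2.1 => //; exact: ZY.
  exact: (FG _ _ FY Yw).2.2.
have G0y : G0 (y, p y) by exists 1; rewrite scale1r.
have Gne : G !=set0.
  apply: contrapT => Gemp; apply: (Gmax G0).
    split; first by move=> u Gu; case: Gemp; exists u.
    by move=> /(_ _ G0y) GG; case: Gemp; exists (y, p y).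
  by move=> _; split => //; exact: line_subfunctional.
have [G0G Gsub] := PG Gne.
have [Glin Gp] := Gsub.
have G00 : G 0.
  by have [u Gu] := Gne; have := Glin (-1) _ _ Gu Gu; rewrite scaleN1r addNr.
have Gtot v : exists r, G (v, r).
  have [c Gc] := subfunctional_extend v Gsub Gne.
  have GGc : G `<=` graph_span G (v, c).
    by move=> u Gu; exists 0, u; rewrite scale0r addr0.
  exists c; have [//|ncG] := pselect (G (v, c)).
  case: (Gmax (graph_span G (v, c))).
    split=> // spanG; apply: ncG; apply: spanG.
    by exists 1, 0; rewrite scale1r add0r.
  by move=> _; split => //; exact: subset_trans GGc.
have Guniq v r s : G (v, r) -> G (v, s) -> r = s.
  move=> Gr Gs; apply/eqP; rewrite eq_le; apply/andP; split.
    have /Gp /= := Glin (-1) _ _ Gs Gr.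
    by rewrite !scaleN1r (addNr v) p0 addrC subr_le0.
  have /Gp /= := Glin (-1) _ _ Gr Gs.
  by rewrite !scaleN1r (addNr v) p0 addrC subr_le0.
have [f Gf] := choice Gtot.
exists f; split=> [t u v|v|].
- by apply: (Guniq (t *: u + v)) => //; exact: (Glin t _ _ (Gf u) (Gf v)).
- exact: (Gp _ (Gf v)).
- by apply: (Guniq y) => //; exact: G0G.
Qed.

End RealHahnBanach.

Section ComplexHahnBanach.
Variables (R : realType) (V : lmodType R[i]).

(** The real vector space underlying a complex one, as an alias carrying its own
    scaling. *)
Definition realification : Type := V.
HB.instance Definition _ := GRing.Zmodule.on realification.

Definition real_scale (t : R) (v : realification) : realification :=
  (t%:C)%C *: (v : V).

Lemma real_scaleA a b v : real_scale a (real_scale b v) = real_scale (a * b) v.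
Proof. by rewrite /real_scale scalerA rmorphM. Qed.
Lemma real_scale1 : left_id 1 real_scale.
Proof. by move=> v; rewrite /real_scale scale1r. Qed.
Lemma real_scaleDr : right_distributive real_scale +%R.
Proof. by move=> a u v; rewrite /real_scale scalerDr. Qed.
Lemma real_scaleDl v : {morph real_scale^~ v : a b / a + b}.
Proof. by move=> a b; rewrite /real_scale rmorphD scalerDl. Qed.
HB.instance Definition _ := GRing.Zmodule_isLmodule.Build R realification
  real_scaleA real_scale1 real_scaleDr real_scaleDl.

(** The real part [f] of the functional is obtained over the reals, and
    [g v = f v - i f (i v)] is complex linear with real part [f].  Rotating [v]
    so that [g v] becomes a nonnegative real transfers the bound from [f] to
    [|g|]. *)
Lemma complex_hahn_banach (p : V -> R[i]) :
  (forall x y, p (x + y) <= p x + p y) ->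
  (forall a x, p (a *: x) = `|a| * p x) ->
  forall y, exists f : V -> R[i],
  [/\ forall a u v, f (a *: u + v) = a * f u + f v,
      forall v, `|f v| <= p v & p y <= `|f y|].
Proof.
move=> pD pZ y.
have p_ge0 v : 0 <= p v.
  have := pD v (- v); rewrite subrr -(scale0r 0) pZ normr0 mul0r -scaleN1r pZ.
  by rewrite normrN1 mul1r -mulr2n pmulrn_lge0.
pose q (v : realification) : R := complex.Re (p v).
have pq v : p v = ((q v)%:C)%C by rewrite RRe_real// ger0_real.
have qD u v : q (u + v) <= q u + q v.
  by have := pD u v; rewrite !pq -rmorphD lecR.
have qZ (t : R) v : 0 <= t -> q (t *: v) = t * q v.
  move=> t0; rewrite /q [_ *: _]/(real_scale t v) /real_scale pZ.
  by rewrite (ger0_norm (x := (t%:C)%C)) ?lecR// pq -rmorphM.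
have [f [flin fq fy]] := real_hahn_banach qD qZ y.
have f0 : f 0 = 0.
  have := flin 1 0 0; rewrite scaler0 addr0 mul1r => /eqP.
  by rewrite -subr_eq subrr => /eqP.
have fD u v : f (u + v) = f u + f v by have := flin 1 u v; rewrite scale1r mul1r.
have fZ (x z : R) (u : V) :
    f ((x +i* z)%C *: u) = x * f u + z * f ('i%C *: u).
  have <- : (x%:C)%C *: u + (z%:C)%C *: ('i%C *: u) = (x +i* z)%C *: u.
    rewrite scalerA -scalerDl; congr (_ *: _).
    by rewrite [RHS]complexE /= [_ * 'i%C]mulrC.
  have := flin x u (z *: (('i%C *: u) : realification)) => ->; congr (_ + _).
  by have := flin z ('i%C *: u) 0; rewrite !addr0 f0 addr0.
pose g (v : V) : R[i] := (f v -i* f ('i%C *: v))%C.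
have gD u v : g (u + v) = g u + g v.
  by rewrite /g scalerDr !fD opprD.
have gZ a u : g (a *: u) = a * g u.
  case: a => x z; rewrite /g scalerA.
  have -> : 'i%C * (x +i* z)%C = ((- z) +i* x)%C :> R[i].
    by apply/eqP; rewrite eq_complex /= !mul0r !mul1r sub0r add0r !eqxx.
  rewrite (fZ x z) (fZ (- z) x); apply/eqP; rewrite eq_complex /=.
  apply/andP; split; apply/eqP.
    by rewrite mulrN opprK.
  by rewrite mulNr opprD opprK mulrN addrC.
exists g; split => [a u v|v|].
- by rewrite gD gZ.
- have [->|gv0] := eqVneq (g v) 0; first by rewrite normr0.
  pose c := `|g v| / g v.
  have gc : g (c *: v) = `|g v| by rewrite gZ /c divfK.
  have -> : p v = p (c *: v).
    by rewrite pZ /c normrM normfV normr_id divff ?mul1r// normr_eq0.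
  have -> : `|g v| = ((f (c *: v))%:C)%C.
    have : complex.Re (g (c *: v)) = f (c *: v) by [].
    by rewrite gc => <-; rewrite RRe_real// normr_real.
  by rewrite pq lecR fq.
- rewrite pq -fy; apply: le_trans (normc_ge_Re (g y)).
  by rewrite lecR /= ler_norm.
Qed.

End ComplexHahnBanach.

(** The last inequality is the usual equality [f y = p y] up to a unimodular
    factor; in this form one statement covers both scalar fields. *)
Lemma hahn_banach (R : realType) (s : scalars) (V : lmodType (scalar_field R s))
    (p : V -> scalar_field R s) :
  (forall x y, p (x + y) <= p x + p y) ->
  (forall a x, p (a *: x) = `|a| * p x) ->
  forall y, exists f : V -> (scalar_field R s)^o,
  [/\ linear f, forall v, `|f v| <= p v & p y <= `|f y|].
Proof.
case: s V p => V p pD pZ y.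
  have [||f [flin fp fy]] := @real_hahn_banach R V p _ _ y.
  - exact: pD.
  - by move=> t x t0; rewrite pZ ger0_norm.
  have fN v : f (- v) = - f v.
    have f0 : f 0 = 0.
      have := flin 1 0 0; rewrite scaler0 addr0 mul1r => /eqP.
      by rewrite -subr_eq subrr => /eqP.
    by have := flin (-1) v 0; rewrite !addr0 scaleN1r f0 addr0 mulN1r.
  exists f; split.
  - exact: flin.
  - move=> v; rewrite (@ler_norml R); rewrite fp andbT lerNl -fN.
    by rewrite (le_trans (fp _))// -scaleN1r pZ normrN1 mul1r.
  - by rewrite -fy; exact: (@ler_norm R).
have [f [flin fp fy]] := @complex_hahn_banach R V p pD pZ y.
by exists f; split.
Qed.

(** * From weak approximation to bounded norm approximation *)

Section NonnegInfimum.
Variable K : scalarFieldType.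

(** The order of the scalars is partial in the complex case, hence the
    restriction of the maximality clause to real lower bounds. *)
Lemma nonneg_infimum (S : set K) : S !=set0 -> (forall x, S x -> 0 <= x) ->
  exists i, [/\ 0 <= i, lbound S i &
    forall l, l \is Num.real -> lbound S l -> l <= i].
Proof.
move=> [x Sx] S0; pose L := [set l | 0 <= l /\ lbound S l].
have L0 : L 0 by split => // y /S0.
have [|||i [iub ilb]] := @nonneg_supremum K L.
- by exists 0.
- by move=> l [].
- by exists x => l [_]; apply.
exists i; split; first exact: iub.
  by move=> y Sy; apply: ilb => l [_]; apply.
move=> l /real_ge0P[l0 lS|l0 _]; first by apply: iub.
by rewrite (le_trans (ltW l0))//; exact: iub.
Qed.
End NonnegInfimum.

Section WeakToNorm.
Variables (R : realType) (s : scalars).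
Let K := scalar_field R s.
Variables (A Y : normedModType K) (T : A -> Y) (e : dual (dual A)) (y : Y).
Hypothesis Tlin : linear T.
Hypothesis eT : forall (g : dual Y) (h : dual A), (forall a, h a = g (T a)) ->
  e h = g y.

(** [eT] says that [y] is the value at [e] of the bitranspose of [T].  Consider
    the seminorm [p v = inf_a (|a| / M + |v - T a| / eps)] with [M = |e| + 1].
    If no [a] in the ball of radius [M] had [T a] within [eps] of [y], then
    [p y >= 1].  A functional [f] dominated by [p] with [|f y| >= p y] satisfies
    [|f (T a)| <= |a| / M], so that [|f y| = |e (f \o T)| <= |e| / M < 1]. *)
Lemma weak_to_norm (eps : K) : 0 < eps ->
  exists a, `|a| <= `|e| + 1 /\ `|T a - y| <= eps.
Proof.
move=> eps0; pose M := `|e| + 1.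
have M0 : 0 < M by rewrite ltr_wpDl.
have [M0' eps0'] := (ltW M0, ltW eps0).
apply: contrapT => /forallNP noa.
pose w (v : Y) (a : A) : K := `|a| / M + `|v - T a| / eps.
have w0 v a : 0 <= w v a by rewrite addr_ge0// mulr_ge0// invr_ge0.
have T0 : T 0 = 0.
  have := Tlin 1 0 0; rewrite scaler0 addr0 scale1r => /eqP.
  by rewrite -subr_eq subrr => /eqP.
have TD u v : T (u + v) = T u + T v by have := Tlin 1 u v; rewrite !scale1r.
have TZ c u : T (c *: u) = c *: T u by have := Tlin c u 0; rewrite T0 !addr0.
have /choice[p pP] v : exists i, [/\ 0 <= i, lbound (range (w v)) i &
    forall l, l \is Num.real -> lbound (range (w v)) l -> l <= i].
  apply: nonneg_infimum; first by exists (w v 0), 0.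
  by move=> _ [a _ <-].
have p0 v : 0 <= p v by have [] := pP v.
have plb v a : p v <= w v a by have [_ + _] := pP v; apply; exists a.
have pgl v l : l \is Num.real -> (forall a, l <= w v a) -> l <= p v.
  by move=> lr lw; have [_ _] := pP v; apply => // _ [a _ <-].
have preal v : p v \is Num.real by rewrite ger0_real.
have wreal v a : w v a \is Num.real by rewrite ger0_real.
have pD u v : p (u + v) <= p u + p v.
  rewrite -lerBlDr; apply: (pgl); first by rewrite realB.
  move=> a; rewrite lerBlDr -lerBlDl; apply: (pgl); first by rewrite realB.
  move=> b; rewrite lerBlDl (le_trans (plb _ (a + b)))// /w TD.
  rewrite addrACA -mulrDl -mulrDl lerD// ler_wpM2r// ?invr_ge0//.
    exact: ler_normD.
  by rewrite opprD addrACA ler_normD.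
have pZ c v : p (c *: v) = `|c| * p v.
  have le d u : p (d *: u) <= `|d| * p u.
    have [->|d0] := eqVneq d 0.
      rewrite scale0r normr0 mul0r (le_trans (plb _ 0))// /w T0 subrr.
      by rewrite !normr0 !mul0r addr0.
    rewrite -ler_pdivrMl ?normr_gt0//; apply: (pgl).
      by rewrite ger0_real// mulr_ge0// invr_ge0.
    move=> a; rewrite ler_pdivrMl ?normr_gt0// (le_trans (plb _ (d *: a)))//.
    by rewrite /w TZ -scalerBr !normrZ mulrDr !mulrA.
  apply/eqP; rewrite eq_le le/=; have [->|c0] := eqVneq c 0.
    by rewrite normr0 mul0r.
  rewrite -ler_pdivlMl ?normr_gt0// -normfV (le_trans _ (le _ _))//.
  by rewrite scalerA mulVf// scale1r.
have py : 1 <= p y.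
  apply: (pgl) => [|a]; first exact: real1.
  have [aM|aM] := real_leP (normr_real a) (gtr0_real M0); last first.
    rewrite (@le_trans _ _ (`|a| / M))//; last first.
      by rewrite lerDl mulr_ge0// invr_ge0.
    by rewrite ler_pdivlMr// mul1r ltW.
  rewrite (@le_trans _ _ (`|y - T a| / eps))//; last first.
    by rewrite lerDr mulr_ge0// invr_ge0.
  rewrite ler_pdivlMr// mul1r distrC.
  have [Ta|/ltW//] := real_leP (normr_real (T a - y)) (gtr0_real eps0).
  by case: (noa a).
have [f [flin fp fy]] := hahn_banach pD pZ y.
have fc : f \in @continuous_functional K Y.
  apply: bounded_functional => //; exists eps^-1 => v.
  rewrite (le_trans (fp v))// (le_trans (plb _ 0))// /w T0 subr0.
  by rewrite normr0 mul0r add0r mulrC.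
pose g : dual Y := Dual fc.
have hbnd a : `|f (T a)| <= M^-1 * `|a|.
  rewrite (le_trans (fp _))// (le_trans (plb _ a))// /w subrr normr0.
  by rewrite mul0r addr0 mulrC.
have hc : (f \o T : A -> K^o) \in @continuous_functional K A.
  apply: bounded_functional; last by exists M^-1.
  by move=> c u v /=; rewrite Tlin flin.
pose h : dual A := Dual hc.
have eh : e h = g y by apply: eT.
have hM : `|h| <= M^-1 by apply: dual_norm_le; rewrite ?invr_ge0 1?ltW.
suff : (1 : K) < 1 by rewrite ltxx.
apply: le_lt_trans (_ : `|e| / M < 1); last first.
  by rewrite ltr_pdivrMr// mul1r /M ltrDl.
rewrite (le_trans py)// (le_trans fy)// -[f y]/(g y) -eh.
by rewrite (le_trans (ler_dual _ _))// ler_wpM2l.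
Qed.

End WeakToNorm.

(** * Completeness of duals and geometric convergence *)

Section Completeness.
Variable K : scalarFieldType.

(** This contains the Archimedean property of the scalars, which follows from
    the existence of suprema: if all [c q^n] exceed [eps], their infimum [i]
    satisfies [eps <= i] and [i / q <= i], which is absurd. *)
Lemma geometric_small (q c eps : K) : 0 <= q -> q < 1 -> 0 <= c -> 0 < eps ->
  exists n, c * q ^+ n <= eps.
Proof.
move=> q0 q1 c0 eps0; apply: contrapT => /forallNP big.
have cq0 n : 0 <= c * q ^+ n by rewrite mulr_ge0// exprn_ge0.
have epsq n : eps <= c * q ^+ n.
  have [/big//|/ltW//] := real_leP (ger0_real (cq0 n)) (gtr0_real eps0).
pose S := range (fun n => c * q ^+ n).
have [i [i0 ilb igl]] : exists i, [/\ 0 <= i, lbound S i &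
    forall l, l \is Num.real -> lbound S l -> l <= i].
  by apply: nonneg_infimum => [|_ [n _ <-]//]; exists (c * q ^+ 0), 0%N.
have ei : eps <= i by apply: igl => [|_ [n _ <-]//]; rewrite gtr0_real.
have qpos : 0 < q.
  rewrite lt_def q0 andbT; apply/eqP => q00.
  by have := epsq 1%N; rewrite q00 expr1 mulr0 (lt_geF eps0).
have : i / q <= i.
  apply: igl => [|_ [n _ <-]]; first by rewrite ger0_real// divr_ge0.
  by rewrite ler_pdivrMr// -mulrA -exprSr; apply: ilb; exists n.+1.
rewrite ler_pdivrMr// -subr_ge0 -[X in _ - X]mulr1 -mulrBr.
by rewrite pmulr_rge0 ?(lt_le_trans eps0 ei)// subr_ge0 (lt_geF q1).
Qed.

Lemma le_small_mul (z C : K) : 0 <= C ->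
  (forall eps, 0 < eps -> z <= eps * C) -> z <= 0.
Proof.
move=> C0 zC; apply/ler_addgt0Pr => eps eps0; rewrite add0r.
have C1 : 0 < C + 1 by rewrite ltr_wpDl.
rewrite (le_trans (zC (eps / (C + 1)) _))//; first by rewrite divr_gt0.
rewrite -mulrA ler_piMr ?(ltW eps0)// mulrC ler_pdivrMr// mul1r.
by rewrite lerDl.
Qed.

Definition seq_tends (X : normedModType K) (u : nat -> X) (l : X) :=
  forall eps : K, 0 < eps -> exists N, forall n, (N <= n)%N -> `|l - u n| <= eps.

(** Completeness is carried by a predicate on sequences because the type
    [iter_dual A k] has no canonical complete structure for variable [k]. *)
Definition seq_complete (X : normedModType K) := forall u : nat -> X,
  (forall eps : K, 0 < eps -> exists N, forall m n, (N <= m)%N -> (N <= n)%N ->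
     `|u m - u n| <= eps) ->
  exists l, seq_tends u l.

Lemma complete_seq_complete (X : completeNormedModType K) : seq_complete X.
Proof.
move=> u uC.
have : cauchy (u @ \oo).
  apply/cauchy_ballP => eps eps0.
  have [N uN] := uC (eps / 2) (divr_gt0 eps0 (ltr0Sn K 1)).
  exists ([set x | exists2 n, (N <= n)%N & x = u n],
          [set x | exists2 n, (N <= n)%N & x = u n]).
    by split; exists N => // n /= Nn; exists n.
  move=> [_ _] [/= [m Nm ->] [n Nn ->]].
  rewrite -ball_normE /ball_ /= (le_lt_trans (uN _ _ Nm Nn))//.
  by rewrite ltr_pdivrMr// mulr_natr mulr2n ltrDl.
move=> /cauchy_cvgP ucvg; exists (lim (u @ \oo)) => eps eps0.
have /cvgrPdist_le/(_ eps eps0)[N _ uN] := ucvg.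
by exists N => n Nn; exact: uN.
Qed.

(** A Cauchy sequence of functionals converges pointwise, uniformly relative to
    the norm; this uniformity gives both the continuity of the limit and the
    convergence in norm. *)
Lemma seq_complete_dual (X : normedModType K) : seq_complete (K^o) ->
  seq_complete (dual X).
Proof.
move=> Kc u uC.
have /choice[l lP] x : exists l : K^o, seq_tends (fun n => u n x) l.
  apply: Kc => eps eps0.
  have x1 : 0 < `|x| + 1 by rewrite ltr_wpDl.
  have [N uN] := uC (eps / (`|x| + 1)) (divr_gt0 eps0 x1).
  exists N => m n Nm Nn; rewrite -[u m x - u n x]/((u m - u n) x).
  rewrite (le_trans (ler_dual _ _))// (le_trans (ler_wpM2r _ (uN _ _ Nm Nn)))//.
  rewrite -mulrA ler_piMr ?(ltW eps0)// mulrC ler_pdivrMr// mul1r.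
  by rewrite lerDl.
have lunif eps : 0 < eps -> exists N, forall n, (N <= n)%N ->
    forall x, `|l x - u n x| <= eps * `|x|.
  move=> eps0; have [N uN] := uC eps eps0; exists N => n Nn x.
  apply/ler_addgt0Pr => eta eta0; have [M lM] := lP x eta eta0.
  have := lM (maxn M N) (leq_maxl _ _); set m := maxn M N => lm.
  rewrite -(subrKA (u m x)) addrC (le_trans (ler_normD _ _))// lerD//.
  rewrite -[u m x - u n x]/((u m - u n) x).
  by rewrite (le_trans (ler_dual _ _))// ler_wpM2r// uN// leq_maxr.
have llin : linear (l : X -> K^o).
  move=> a x y; apply/eqP; rewrite -subr_eq0 -normr_le0.
  apply: (@le_small_mul _ (`|a *: x + y| + (`|a| * `|x| + `|y|))).
    by rewrite !addr_ge0// mulr_ge0.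
  move=> eps eps0; have [N lN] := lunif eps eps0.
  have {}lN := lN N (leqnn N).
  have -> : l (a *: x + y) - (a *: l x + l y) =
      (l (a *: x + y) - u N (a *: x + y)) -
      (a *: (l x - u N x) + (l y - u N y)).
    rewrite (dual_linear (u N)) scalerBr [X in _ = _ - X]addrACA -opprD opprB.
    by rewrite subrKA.
  rewrite (le_trans (ler_normB _ _))// mulrDr lerD//.
  rewrite (le_trans (ler_normD _ _))// mulrDr lerD//.
  by rewrite normrZ mulrCA ler_wpM2l.
have lc : (l : X -> K^o) \in @continuous_functional K X.
  apply: bounded_functional => //.
  have [N lN] := lunif 1 ltr01; exists (1 + `|u N|) => x.
  rewrite -[l x](subrK (u N x)) mulrDl (le_trans (ler_normD _ _))// lerD//.
    exact: lN.
  exact: ler_dual.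
exists (Dual lc) => eps eps0; have [N lN] := lunif eps eps0.
exists N => n Nn; apply: dual_norm_le; first exact: ltW.
by move=> x; exact: lN.
Qed.

Lemma geometric_limit (X : normedModType K) (u : nat -> X) (c q : K) :
  seq_complete X -> 0 <= c -> 0 <= q -> q < 1 ->
  (forall n, `|u n.+1 - u n| <= c * q ^+ n) ->
  exists l, forall n, `|l - u n| <= c / (1 - q) * q ^+ n.
Proof.
move=> Xc c0 q0 q1 uq.
have q10 : 0 < 1 - q by rewrite subr_gt0.
pose C := c / (1 - q).
have C0 : 0 <= C by rewrite divr_ge0// ltW.
have uk n k : `|u (n + k)%N - u n| <= C * q ^+ n.
  suff : `|u (n + k)%N - u n| <= C * (q ^+ n - q ^+ (n + k)).
    move=> /le_trans; apply; rewrite ler_wpM2l// lerBlDr lerDl.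
    exact: exprn_ge0.
  elim: k => [|k IH]; first by rewrite addn0 !subrr normr0 mulr0.
  rewrite addnS -(subrKA (u (n + k)%N)) (le_trans (ler_normD _ _))//.
  rewrite (le_trans (lerD (uq _) IH))//.
  have -> : c * q ^+ (n + k) = C * (q ^+ (n + k) - q ^+ (n + k).+1).
    rewrite exprS -[X in _ * (X - _)]mul1r -mulrBl mulrA /C divfK//.
    by rewrite gt_eqF.
  by rewrite -mulrDr addrC subrKA.
have [l lP] : exists l, seq_tends u l.
  apply: Xc => eps eps0.
  have [N NC] := geometric_small q0 q1 (mulr_ge0 C0 (ler0n K 2)) eps0.
  exists N => m n /subnKC <- /subnKC <-.
  rewrite -(subrKA (u N)) (le_trans (ler_normD _ _))//.
  rewrite [X in _ + X]distrC (le_trans (lerD (uk _ _) (uk _ _)))//.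
  by rewrite -mulr2n -mulr_natr mulrAC.
exists l => n; apply/ler_addgt0Pr => eps eps0; have [N lN] := lP _ eps0.
rewrite -(subrKA (u (n + N)%N)) addrC (le_trans (ler_normD _ _))// lerD//.
by rewrite lN// leq_addl.
Qed.

End Completeness.

Lemma seq_complete_scalar_field (R : realType) (s : scalars) :
  seq_complete ((scalar_field R s)^o).
Proof.
case: s; first exact: (@complete_seq_complete R (R^o)).
move=> u uC.
have norm_i : `|'i%C : R[i]| = 1.
  by rewrite normc_def /= expr0n expr1n add0r sqrtr1.
have Re_le (z : R[i]) (eps : R) : `|z| <= (eps%:C)%C -> `|complex.Re z| <= eps.
  by move=> /(le_trans (normc_ge_Re z)); rewrite lecR.
have Im_le (z : R[i]) (eps : R) : `|z| <= (eps%:C)%C -> `|complex.Im z| <= eps.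
  move=> zeps; have := @Re_le ('i%C * z) eps.
  rewrite normrM norm_i mul1r => /(_ zeps).
  by case: z zeps => a b _ /=; rewrite mul0r mul1r sub0r normrN.
have uC' (eps : R) : 0 < eps -> exists N, forall m n, (N <= m)%N -> (N <= n)%N ->
    `|u m - u n| <= (eps%:C)%C.
  by move=> eps0; apply: uC; rewrite ltcR.
have [a aP] : exists a, seq_tends (fun n => complex.Re (u n) : R^o) a.
  apply: (@complete_seq_complete R (R^o)) => eps /uC'[N uN].
  by exists N => m n Nm Nn; rewrite -raddfB; apply/Re_le/uN.
have [b bP] : exists b, seq_tends (fun n => complex.Im (u n) : R^o) b.
  apply: (@complete_seq_complete R (R^o)) => eps /uC'[N uN].
  by exists N => m n Nm Nn; rewrite -raddfB; apply/Im_le/uN.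
exists (a +i* b)%C => eps eps0.
have epsE : ((complex.Re eps)%:C)%C = eps by rewrite RRe_real// gtr0_real.
have e0 : 0 < complex.Re eps / 2 by rewrite divr_gt0// -ltcR epsE.
have [N1 aN] := aP _ e0; have [N2 bN] := bP _ e0.
exists (maxn N1 N2) => n; rewrite geq_max => /andP[/aN an /bN bn].
rewrite [X in `|X|]complexE (le_trans (ler_normD _ _))//.
rewrite normrM norm_i mul1r -epsE [complex.Re eps]splitr.
rewrite rmorphD lerD// normc_def /= expr0n/= addr0 sqrtr_sqr lecR.
  by move: an; case: (u n).
by move: bn; case: (u n).
Qed.

(** * Cohen factorization *)

Lemma le_geometric (K : scalarFieldType) (z C q : K) :
  0 <= q -> q < 1 -> 0 <= C -> (forall n, z <= C * q ^+ n) -> z <= 0.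
Proof.
move=> q0 q1 C0 zC; apply/ler_addgt0Pr => eps eps0; rewrite add0r.
by have [n] := geometric_small q0 q1 C0 eps0; exact: le_trans.
Qed.

(** The iteration in the open mapping theorem: solving [G z = y] up to half the
    size of [y] with [|z| <= kappa |y|], and then repeating with the error,
    yields an exact solution bounded by [2 kappa |y|]. *)
Lemma successive_approximation (K : scalarFieldType) (X : normedModType K)
    (G : X -> X) (b kappa : K) :
  seq_complete X -> 0 <= kappa ->
  {morph G : x y / x + y} -> (forall x, `|G x| <= b * `|x|) ->
  (forall y, exists z, `|z| <= kappa * `|y| /\ `|y - G z| <= 2^-1 * `|y|) ->
  forall y, exists z, G z = y /\ `|z| <= 2 * kappa * `|y|.
Proof.
move=> Xc k0 GD Gb /choice[z zP] y.
have G0 : G 0 = 0.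
  by have /eqP := GD 0 0; rewrite addr0 -subr_eq subrr => /eqP.
have GN x : G (- x) = - G x by apply/eqP; rewrite -addr_eq0 -GD addNr G0.
pose h : K := 2^-1.
have h0 : 0 <= h by rewrite invr_ge0.
have h1 : h < 1 by rewrite invf_lt1// ltr1n.
have hh : 1 - h = h by rewrite /h [X in X - _](splitr 1) mul1r addrK.
pose r n := iter n (fun v => v - G (z v)) y.
have rE n : r n.+1 = r n - G (z (r n)) by [].
have rb n : `|r n| <= `|y| * h ^+ n.
  elim: n => [|n IH]; first by rewrite mulr1.
  rewrite rE (le_trans (zP _).2)// exprS mulrCA ler_wpM2l//.
pose t n := \sum_(i < n) z (r i).
have tE n : t n.+1 = t n + z (r n) by rewrite /t big_ord_recr.
have Gt n : G (t n) = y - r n.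
  elim: n => [|n IH]; first by rewrite /t big_ord0 G0 subrr.
  by rewrite tE GD IH rE opprB addrA addrAC.
have [|||n|l lP] := @geometric_limit K X t (kappa * `|y|) h Xc.
- by rewrite mulr_ge0.
- exact: h0.
- exact: h1.
- rewrite tE addrC addKr (le_trans (zP _).1)// -mulrA ler_wpM2l//.
exists l; split; last first.
  have := lP 0%N; rewrite /t big_ord0 subr0 expr0 mulr1 => /le_trans; apply.
  by rewrite hh /h invrK mulrC mulrA.
apply/eqP; rewrite -subr_eq0 -normr_le0.
apply: (@le_geometric _ _ (`|b| * (kappa * `|y| / (1 - h)) + `|y|) h) => //.
  by rewrite addr_ge0// !mulr_ge0// hh invr_ge0.
move=> n; have -> : G l - y = G (l - t n) - r n.
  by rewrite GD GN Gt opprB addrA [RHS]addrAC addrK.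
rewrite (le_trans (ler_normB _ _))// mulrDl lerD//.
have b0 : 0 <= b * `|l - t n| by rewrite (le_trans _ (Gb _)).
rewrite (le_trans (Gb _))// -(ger0_norm b0) normrM normr_id.
by rewrite -[leRHS]mulrA ler_wpM2l.
Qed.

Section CohenFactorization.
Variables (K : scalarFieldType) (A X : normedModType K).
Variables (m : A -> A -> A) (L : bbilinear A X X) (M : K).
Hypotheses (Ac : seq_complete A) (Xc : seq_complete X).
Hypothesis LM : forall a b x, L (m a b) x = L a (L b x).
Hypothesis M0 : 0 <= M.
Hypothesis approx : forall a x (eps : K), 0 < eps ->
  exists u, [/\ `|u| <= M, `|m a u - a| <= eps & `|L u x - x| <= eps].

(** The action on [X] of [a + c 1], an element of the unitization of [A]. *)
Definition shifted (a : A) (c : K) (x : X) : X := L a x + c *: x.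

(** Surjectivity with constant [kappa] is all that the iteration needs from the
    inverse of [a + c 1]. *)
Definition solvable_with (a : A) (c kappa : K) :=
  forall y, exists z, shifted a c z = y /\ `|z| <= kappa * `|y|.

Lemma shiftedD a c : {morph shifted a c : x y / x + y}.
Proof. by move=> x y; rewrite /shifted linearDr scalerDr addrACA. Qed.

Lemma shifted_bounded a c : exists b, forall x, `|shifted a c x| <= b * `|x|.
Proof.
have [N N0 LN] := bbilinear_bound L; exists (N * `|a| + `|c|) => x.
by rewrite /shifted (le_trans (ler_normD _ _))// normrZ mulrDl lerD.
Qed.

(** With [mu = 1 - lambda] and [C = mu + lambda u], the new operator
    [a + lambda c u + mu c] equals [(a + c) C - lambda (a u - a)].  The factor
    [C] is solvable with constant [4] because [lambda u] is small, and the last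
    term is negligible because [a u] is close to [a]; hence the constant
    [8 kappa], which does not depend on [u].  The correction from [x] to [x']
    solves an equation with right-hand side [lambda c (x - u x)], which is small
    because [u x] is close to [x]. *)
Lemma cohen_step (N lambda : K) (a : A) (c kappa : K) (x0 x : X) :
  0 <= N -> (forall a x, `|L a x| <= N * `|a| * `|x|) ->
  0 < lambda -> 2 * lambda <= 1 -> 4 * (lambda * (N * M)) <= 1 ->
  0 < c -> 0 < kappa ->
  solvable_with a c kappa -> shifted a c x = x0 ->
  exists u x', [/\ `|u| <= M,
    solvable_with (a + (lambda * c) *: u) ((1 - lambda) * c) (8 * kappa),
    shifted (a + (lambda * c) *: u) ((1 - lambda) * c) x' = x0 &
    `|x' - x| <= c].
Proof.
move=> N0 LN l0 l2 lNM c0 k0 solv xx0.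
have N1 : 0 < N + 1 by rewrite ltr_wpDl.
have k8 : 0 < 8 * kappa by rewrite mulr_gt0// ltr0n.
(* With this [d], both [8 kappa d <= 1] and [4 kappa N d <= 1]. *)
pose d := (8 * kappa * (N + 1))^-1.
have d0 : 0 < d by rewrite invr_gt0 mulr_gt0.
have [u [uM ua ux]] := approx a x d0.
have d8 : 8 * kappa * d <= 1.
  rewrite /d invfM mulrA divff ?gt_eqF// mul1r invf_le1// lerDr//.
have Nd : N * d * (4 * kappa) <= 1.
  rewrite [leRHS](_ : 1 = (N + 1) * d * (8 * kappa)); last first.
    by rewrite [RHS]mulrC mulrA mulfV// gt_eqF// mulr_gt0.
  have [d0' k0'] := (ltW d0, ltW k0).
  by apply: ler_pM; rewrite ?mulr_ge0 ?ler_wpM2r ?lerDl ?ler_nat.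
pose mu := 1 - lambda.
have l1 : lambda <= 2^-1 by rewrite -[_^-1]mul1r ler_pdivlMr// mulrC.
have half : 1 - 2^-1 = 2^-1 :> K by rewrite [X in X - _](splitr 1) mul1r addrK.
have mu2 : 2^-1 <= mu by rewrite /mu lerBrDr -lerBrDl half.
have mu0 : 0 < mu by rewrite (lt_le_trans _ mu2)// invr_gt0.
have muV : mu^-1 <= 2 by rewrite -[2]invrK lef_pV2// posrE ?invr_gt0.
have [l0' c0' k0' mu0'] := And4 (ltW l0) (ltW c0) (ltW k0) (ltW mu0).
pose a' := a + (lambda * c) *: u.
have Lu z : `|lambda *: L u z| <= lambda * (N * M) * `|z|.
  rewrite normrZ gtr0_norm// -mulrA ler_wpM2l// (le_trans (LN _ _))//.
  by rewrite ler_wpM2r// ler_wpM2l.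
have solvC : solvable_with (lambda *: u) mu 4.
  have [b bP] := shifted_bounded (lambda *: u) mu.
  have := successive_approximation Xc (ler0n K 2) (@shiftedD _ _) bP.
  rewrite -natrM; apply => y; exists (mu^-1 *: y); split.
    by rewrite normrZ ger0_norm ?invr_ge0// ler_wpM2r.
  rewrite /shifted linearZl_LR /= scalerA divff ?gt_eqF// scale1r.
  rewrite opprD addrCA subrr addr0 normrN (le_trans (Lu _))//.
  rewrite normrZ ger0_norm ?invr_ge0// (mulrA (lambda * _)) ler_wpM2r//.
  rewrite (le_trans (ler_wpM2l _ muV))//; first by rewrite !mulr_ge0.
  rewrite -[X in _ <= X]mul1r ler_pdivlMr// -mulrA -natrM mulrC.
  exact: lNM.
have a'E z : shifted a' (mu * c) z =
    shifted a c (shifted (lambda *: u) mu z) - lambda *: L (m a u - a) z.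
  rewrite /shifted /a' linearDl !linearZl_LR linearBl LM linearDr !linearZr_LR.
  rewrite [RHS]addrAC scalerBr opprB [_ + (_ - _)]addrC subrKA -scalerDl.
  rewrite [lambda + mu]addrC subrK scale1r scalerDr !scalerA -addrA.
  by rewrite [c * lambda]mulrC [c * mu]mulrC.
have solv' : solvable_with a' (mu * c) (8 * kappa).
  have [b bP] := shifted_bounded a' (mu * c).
  have k4 : 0 <= 4 * kappa by rewrite mulr_ge0// ltW.
  have := successive_approximation Xc k4 (@shiftedD _ _) bP.
  rewrite mulrA -natrM; apply => y.
  have [v [vy vb]] := solv y; have [z [zv zb]] := solvC v.
  have zy : `|z| <= 4 * kappa * `|y|.
    by rewrite (le_trans zb)// -mulrA ler_wpM2l.
  exists z; split=> //; rewrite a'E zv vy opprB addrCA subrr addr0.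
  rewrite normrZ gtr0_norm// (le_trans (ler_wpM2l (ltW l0) (LN _ _)))//.
  have := ler_pM (mulr_ge0 N0 (normr_ge0 _)) (normr_ge0 z) (ler_wpM2l N0 ua) zy.
  move=> /(ler_wpM2l (ltW l0)) /le_trans; apply.
  rewrite (mulrA (N * d)).
  rewrite (le_trans (ler_wpM2l l0' (ler_wpM2r (normr_ge0 y) Nd)))//.
  by rewrite mul1r ler_wpM2r.
have [z [zE zb]] := solv' (lambda * c *: (x - L u x)).
exists u, (x + z); split => //.
  rewrite shiftedD zE -xx0 /shifted /a' linearDl /= linearZl_LR .
  have cancel (P Y Z W : X) : P + Y + Z + (W - Y) = P + (Z + W).
    rewrite -!addrA; congr +%R; rewrite addrCA; congr +%R.
    by rewrite addrCA subrr addr0.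
  by rewrite scalerBr cancel -scalerDl -mulrDl subrK mul1r.
rewrite addrC addKr (le_trans zb)// normrZ gtr0_norm ?mulr_gt0// mulrCA distrC.
have k8' := ltW k8.
rewrite (@le_trans _ _ (lambda * c * 1))//; last first.
  by rewrite mulr1 ler_piMl// (le_trans l1)// invf_le1// ler1n.
by rewrite ler_wpM2l ?mulr_ge0// (le_trans _ d8)// ler_wpM2l.
Qed.

(** Iterating [cohen_step] from [a = 0], [c = 1] produces [a_n] and [y_n] with
    [(a_n + mu^n) y_n = x] and increments of order [mu^n]; in the limit
    [a y = x]. *)
Lemma cohen_factorization x : exists a y, L a y = x.
Proof.
have [N N0 LN] := bbilinear_bound L.
have NM0 : 0 <= N * M by rewrite mulr_ge0.
pose lambda : K := (2 + 4 * (N * M))^-1.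
have den0 : 0 < 2 + 4 * (N * M) by rewrite ltr_wpDr// mulr_ge0.
have l0 : 0 < lambda by rewrite invr_gt0.
have l2 : 2 * lambda <= 1 by rewrite ler_pdivrMr// mul1r lerDl mulr_ge0.
have lNM : 4 * (lambda * (N * M)) <= 1.
  by rewrite mulrCA mulrC ler_pdivrMr// mul1r lerDr.
pose mu := 1 - lambda.
have l1 : lambda < 1.
  by rewrite (lt_le_trans _ l2)// mulr_natl mulr2n ltrDl.
have mu0 : 0 < mu by rewrite subr_gt0.
have mu1 : mu < 1 by rewrite ltrBlDr ltrDl.
pose good n (s : A * X) := (exists2 kappa, 0 < kappa &
  solvable_with s.1 (mu ^+ n) kappa) /\ shifted s.1 (mu ^+ n) s.2 = x.
have step n s : good n s -> exists s', [/\ good n.+1 s',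
    `|s'.1 - s.1| <= lambda * M * mu ^+ n & `|s'.2 - s.2| <= 1 * mu ^+ n].
  move=> [[kappa k0 solv] sx].
  have mun0 : 0 < mu ^+ n by rewrite exprn_gt0.
  have [u [x' [uM solv' x'x dx]]] :=
    cohen_step N0 LN l0 l2 lNM mun0 k0 solv sx.
  exists (s.1 + (lambda * mu ^+ n) *: u, x'); split => /=.
  - split; last by rewrite exprS.
    by exists (8 * kappa); rewrite ?mulr_gt0 ?ltr0n// exprS.
  - rewrite addrC addKr normrZ gtr0_norm ?mulr_gt0// mulrAC.
    by rewrite ler_wpM2r ?(ltW mun0)// ler_wpM2l// ltW.
  - by rewrite mul1r.
have good0 : good 0%N (0, x).
  split=> /=; last by rewrite /shifted linear0l add0r expr0 scale1r.
  exists 1 => // y; exists y.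
  by rewrite /shifted linear0l add0r expr0 scale1r mul1r.
have [f fP] : exists f : nat -> A * X, forall n, [/\ good n (f n),
    `|(f n.+1).1 - (f n).1| <= lambda * M * mu ^+ n &
    `|(f n.+1).2 - (f n).2| <= 1 * mu ^+ n].
  (* [step] is made total by an arbitrary value outside [good]. *)
  have /choice[F FP] (ns : nat * (A * X)) : exists s', good ns.1 ns.2 ->
      [/\ good ns.1.+1 s', `|s'.1 - ns.2.1| <= lambda * M * mu ^+ ns.1 &
          `|s'.2 - ns.2.2| <= 1 * mu ^+ ns.1].
    have [/step[s' s'P]|ng] := pselect (good ns.1 ns.2); first by exists s'.
    by exists 0.
  pose f := fix f n := if n is n'.+1 then F (n', f n') else (0, x).
  have gf n : good n (f n) by elim: n => // n /(FP (n, f n))[].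
  by exists f => n; have [] := FP (n, f n) (gf n).
have lM0 : 0 <= lambda * M by rewrite mulr_ge0// ltW.
have mu10 : 0 <= 1 - mu by rewrite subr_ge0 ltW.
have [a [Ca [Ca0 aP]]] : exists a Ca, 0 <= Ca /\
    forall n, `|a - (f n).1| <= Ca * mu ^+ n.
  have [|n|a aP] := geometric_limit (u := fun n => (f n).1) Ac lM0 _ mu1.
  - exact: ltW.
  - by have [] := fP n.
  by exists a, (lambda * M / (1 - mu)); split; first exact: divr_ge0.
have [y [Cy [Cy0 yP]]] : exists y Cy, 0 <= Cy /\
    forall n, `|y - (f n).2| <= Cy * mu ^+ n.
  have [|n|y yP] := geometric_limit (u := fun n => (f n).2) Xc ler01 _ mu1.
  - exact: ltW.
  - by have [] := fP n.
  by exists y, (1 / (1 - mu)); split; first exact: divr_ge0.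
exists a, y; apply/eqP; rewrite -subr_eq0 -normr_le0.
apply: (@le_geometric _ _ (N * Ca * `|y| + N * (`|a| + Ca) * Cy + (`|y| + Cy)) mu).
- exact: ltW.
- exact: mu1.
- apply: addr_ge0; last exact: addr_ge0.
  by do ![apply: addr_ge0 => //|apply: mulr_ge0 => //].
move=> n; have [[_ xE] _ _] := fP n.
set an := (f n).1 in xE; set yn := (f n).2 in xE.
have pn0 : 0 <= mu ^+ n by rewrite exprn_ge0// ltW.
have pn1 : mu ^+ n <= 1 by rewrite exprn_ile1// ltW.
have an_le : `|an| <= `|a| + Ca.
  rewrite -[an](subrK a) addrC (le_trans (ler_normD _ _))// lerD//.
  by rewrite distrC (le_trans (aP n))// ler_piMr.
have yn_le : `|yn| <= `|y| + Cy.
  rewrite -[yn](subrK y) addrC (le_trans (ler_normD _ _))// lerD//.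
  by rewrite distrC (le_trans (yP n))// ler_piMr.
have -> : L a y - x = L (a - an) y + L an (y - yn) - mu ^+ n *: yn.
  rewrite -xE /shifted linearBl linearBr/= opprD addrA; congr (_ - _).
  by rewrite addrA subrK.
rewrite (le_trans (ler_normB _ _))// mulrDl lerD//; last first.
  by rewrite normrZ ger0_norm// mulrC ler_wpM2r.
rewrite (le_trans (ler_normD _ _))// mulrDl lerD//.
  rewrite (le_trans (LN _ _))// -!mulrA ler_wpM2l// [leRHS]mulrCA [leLHS]mulrC.
  by rewrite ler_wpM2l// aP.
rewrite (le_trans (LN _ _))// -!mulrA ler_wpM2l// ler_pM//.
exact: yP.
Qed.

End CohenFactorization.

(** * Nets converging weak* to an element of the bidual *)

Section FiniteInterpolation.
Variables (K : scalarFieldType) (A : normedModType K).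

Lemma dual_axpy (X : normedModType K) (f : dual X) c x y :
  f (x + c *: y) = f x + c * f y.
Proof. by rewrite linearD linearZ. Qed.

(** A functional that vanishes on the joint kernel of finitely many others is a
    linear combination of them.  Testing against [e] expresses this without
    naming the coefficients. *)
Lemma joint_kernel (fs : seq (dual A)) (f : dual A) :
  (forall a, (forall g, g \in fs -> g a = 0) -> f a = 0) ->
  forall e : dual (dual A), (forall g, g \in fs -> e g = 0) -> e f = 0.
Proof.
elim: fs f => [|g fs IH] f fker e eker.
  by have -> : f = 0 by [apply: dual_ext => a; exact: fker]; rewrite linear0.
have efs h : h \in fs -> e h = 0 by move=> hfs; rewrite eker// inE hfs orbT.
have [[b [bker gb]]|nob] :=
    pselect (exists b, (forall h, h \in fs -> h b = 0) /\ g b <> 0).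
  have {gb} gb : g b != 0 by apply/eqP.
  have : e (f + (- (f b / g b)) *: g) = 0.
    apply: IH => // a aker.
    have : f (a + (- (g a / g b)) *: b) = 0.
      apply: fker => h; rewrite inE dual_axpy => /predU1P[->|hfs].
        by rewrite mulNr divfK// subrr.
      by rewrite (aker h)// (bker h)// mulr0 addr0.
    rewrite dual_axpy dualDE dualZE => <-; congr (_ + _).
    by rewrite -[_ *: g a]/(_ * g a) !mulNr mulrAC [g a / _ * _]mulrAC [g a * _]mulrC.
  by rewrite dual_axpy (eker g) ?mem_head// mulr0 addr0.
apply: IH => // a aker; apply: fker => h; rewrite inE => /predU1P[->|/aker//].
by apply: contrapT => ga; apply: nob; exists a.
Qed.

Lemma finite_interpolation (fs : seq (dual A)) (e : dual (dual A)) :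
  exists a, forall f, f \in fs -> f a = e f.
Proof.
elim: fs => [|f fs [a aP]]; first by exists 0.
have [[b [bker fb]]|nob] :=
    pselect (exists b, (forall h, h \in fs -> h b = 0) /\ f b <> 0).
  have {fb} fb : f b != 0 by apply/eqP.
  exists (a + ((e f - f a) / f b) *: b) => h; rewrite inE dual_axpy.
  move=> /predU1P[->|hfs]; last by rewrite aP// (bker h)// mulr0 addr0.
  by rewrite divfK// addrC subrK.
exists a => h; rewrite inE => /predU1P[->|/aP//].
apply/esym/eqP; rewrite -subr_eq0; apply/eqP.
apply: (@joint_kernel fs f _ (e - canon_emb a)) => [b bker|g gfs].
  by apply: contrapT => fb; apply: nob; exists b.
by rewrite dualDE /= -aP// subrr.
Qed.

End FiniteInterpolation.

Section WeakStarNets.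
Variable K : scalarFieldType.

Lemma initial_cvgP (S : choiceType) (T : topologicalType) (f : S -> T)
    (F : set_system S) (s : S) : Filter F ->
  (F --> (s : initial_topology f)) <-> f @ F --> f s.
Proof.
move=> FF; split=> [cFs|cfF].
  by move=> U /(@initial_continuous _ _ f s)/cFs.
move=> U /= [_ [[V Vop <-] Vfs sVU]].
have /cfF fV : nbhs (f s) V by rewrite nbhsE; exists V.
exact: (filterS sVU fV).
Qed.

Lemma weak_star_cvgP (X : normedModType K) (I : Type) (F : set_system I)
    (u : I -> dual X) (l : dual X) : Filter F ->
  (u i @[i --> F] --> (l : weak_star X)) <->
  (forall x, u i x @[i --> F] --> (l x : K^o)).
Proof.
by move=> FF; split=> [/initial_cvgP/pointwise_cvgP//|ul];
  apply/initial_cvgP/pointwise_cvgP.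
Qed.

Lemma weak_cvgP (X : normedModType K) (I : Type) (F : set_system I)
    (u : I -> X) (l : X) : Filter F ->
  (u i @[i --> F] --> (l : weak X)) <->
  (forall f : dual X, f (u i) @[i --> F] --> (f l : K^o)).
Proof.
by move=> FF; split=> [/initial_cvgP/pointwise_cvgP//|ul];
  apply/initial_cvgP/pointwise_cvgP.
Qed.

Lemma net_filter_proper (I : Type) (le : I -> I -> Prop) :
  directed le -> ProperFilter (net_filter le).
Proof.
move=> [[i0] lexx letr ledir]; apply: Build_ProperFilter.
  by move=> [i /(_ i (lexx i))].
split.
- by exists i0.
- move=> P Q [i iP] [j jQ]; have [k ik jk] := ledir i j.
  by exists k => l kl; split; [apply/iP/letr/kl|apply/jQ/letr/kl].
- by move=> P Q PQ [i iP]; exists i => j /iP/PQ.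
Qed.

Variable A : normedModType K.

(** The index set of the nets below: finite lists of functionals, ordered by
    inclusion of their entries. *)
Definition incl (F G : seq (dual A)) : Prop := {subset F <= G}.

Lemma incl_directed : directed incl.
Proof.
split.
- exact: (inhabits [::]).
- by move=> F f.
- by move=> F G H FG GH f /FG/GH.
- by move=> F G; exists (F ++ G) => f fF; rewrite mem_cat fF ?orbT.
Qed.

Lemma incl_cofinal (f : dual A) (P : seq (dual A) -> Prop) :
  (forall F, f \in F -> P F) -> \forall F \near net_filter incl, P F.
Proof. by move=> fP; exists [:: f] => F fF; apply: fP; apply: fF; rewrite inE. Qed.

(** The net interpolates [e] exactly on each finite list, so that the pairing
    with any given functional is eventually constant. *)
Lemma weak_star_density (e : dual (dual A)) : exists a : seq (dual A) -> A,
  (forall (F : seq (dual A)) (f : dual A), f \in F -> f (a F) = e f) /\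
  (canon_emb (a F) @[F --> net_filter incl] --> (e : weak_star (dual A))).
Proof.
have FF := net_filter_proper incl_directed.
have /choice[a aP] (F : seq (dual A)) := finite_interpolation F e.
exists a; split=> //; apply/weak_star_cvgP => f.
apply: cvg_near_cst; apply: (incl_cofinal (f := f)) => F fF.
exact: aP.
Qed.

(** Along the net of [weak_star_density] the numbers [phi a x] converge to
    [phi e x] by continuity, and are eventually equal to [e h] by
    interpolation. *)
Lemma weak_star_continuous_eval (B : normedModType K)
    (phi : dual (dual A) -> dual (dual B)) (e : dual (dual A)) :
  @net_continuous_at (weak_star (dual A)) (weak_star (dual B)) phi e ->
  forall x (h : dual A), (forall a, phi (canon_emb a) x = h a) -> phi e x = e h.
Proof.
move=> phic x h phih; have [a [aP ae]] := weak_star_density e.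
have FF := net_filter_proper incl_directed.
have /weak_star_cvgP/(_ x) := phic _ _ _ incl_directed ae.
move=> /(cvg_unique (@norm_hausdorff _ (K^o))); apply.
apply: cvg_near_cst; apply: (incl_cofinal (f := h)) => F hF.
by rewrite phih aP.
Qed.

Lemma weak_star_weak (B : normedModType K)
    (phi : dual (dual A) -> dual (dual B)) (e : dual (dual A)) :
  @net_continuous_at (weak_star (dual A)) (weak (dual (dual B))) phi e ->
  @net_continuous_at (weak_star (dual A)) (weak_star (dual B)) phi e.
Proof.
move=> phic I le u Idir ue; have FF := net_filter_proper Idir.
apply/weak_star_cvgP => x.
have /weak_cvgP := phic I le u Idir ue.
by move=> /(_ (canon_emb x)).
Qed.

(** The functionals [b |-> xi (phi b a)] with [a] in the net of
    [weak_star_density] lie in [S] and converge pointwise to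
    [b |-> xi (phi b e)], which is [xi]. *)
Lemma weak_star_closure_net (B : normedModType K) (e : dual (dual A))
    (phi : dual (dual B) -> dual (dual A) -> dual (dual B))
    (S : set (dual (dual (dual B)))) (xi : dual (dual (dual B))) :
  (forall b, phi b e = b) ->
  (forall b, @net_continuous_at (weak_star (dual A)) (weak (dual (dual B)))
     (phi b) e) ->
  (forall a, exists2 s, S s & forall b, s b = xi (phi b (canon_emb a))) ->
  weak_star_closure S xi.
Proof.
move=> phie phic Sphi; have [a [_ ae]] := weak_star_density e.
have FF := net_filter_proper incl_directed.
have /choice[t tP] (F : seq (dual A)) : exists t, S t /\
    forall b, t b = xi (phi b (canon_emb (a F))).
  by have [t St tE] := Sphi (a F); exists t.
have txi : t F @[F --> net_filter incl] --> (xi : weak_star (dual (dual B))).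
  apply/weak_star_cvgP => b.
  have /weak_cvgP/(_ xi) := phic b _ _ _ incl_directed ae.
  rewrite phie; apply: cvg_trans; apply: near_eq_cvg.
  by apply: nearW => F; rewrite (tP F).2.
move=> U /txi UF; have [F UtF] := @filter_ex _ _ FF _ UF.
by exists (t F); split => //; exact: (tP F).1.
Qed.

End WeakStarNets.

(** * Arens extensions of the module laws *)

Section ArensLaws.
Variable K : scalarFieldType.

(** The common form of the associativity of the product and of the two module
    laws.  Each side is [x] applied to a functional, that functional is [y]
    applied to another one, and so on; peeling off [x], [y], [z] in this order
    reduces the claim to the original law. *)
Lemma arens_ext_associative (X Y Z U V W : normedModType K)
    (g : bbilinear X Y U) (f : bbilinear U Z W)
    (k : bbilinear Y Z V) (h : bbilinear X V W) :
  (forall x y z, f (g x y) z = h x (k y z)) ->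
  forall x y z, arens_ext f (arens_ext g x y) z =
                arens_ext h x (arens_ext k y z).
Proof.
move=> fg x y z; apply: dual_ext => w /=; congr (dual_fun x _).
apply: dual_ext => a /=; congr (dual_fun y _).
apply: dual_ext => b /=; congr (dual_fun z _).
by apply: dual_ext => c /=; rewrite fg.
Qed.

(** The part of the bimodule axioms that makes the dual of [B] a left and a
    right module. *)
Definition action_laws (A B : normedModType K) (D : bimod_data A B) :=
  (forall a1 a2 b, lact D (amul D a1 a2) b = lact D a1 (lact D a2 b)) /\
  (forall b a1 a2, ract D b (amul D a1 a2) = ract D (ract D b a1) a2).

Lemma arens_action_laws (A B : normedModType K) (D : bimod_data A B) :
  action_laws D -> action_laws (arens_data D).
Proof.
move=> [lD rD]; split=> x y z; first exact: arens_ext_associative.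
by apply/esym; apply: arens_ext_associative => *; rewrite rD.
Qed.

(** The structure at level [k + 2] extends that at level [k], so the induction
    runs on two consecutive levels. *)
Lemma tower_action_laws (A B : normedModType K) (D0 : bimod_data A B)
    (D1 : bimod_data (dual A) (dual B)) :
  action_laws D0 -> action_laws D1 ->
  forall k, action_laws (bimod_tower D0 D1 k).
Proof.
move=> l0 l1 k; suff: action_laws (bimod_tower D0 D1 k) /\
    action_laws (bimod_tower D0 D1 k.+1) by case.
by elim: k => // k [lk lk1]; split=> //; exact: arens_action_laws.
Qed.

Lemma dual_lactM (A B : normedModType K) (D : bimod_data A B) :
  action_laws D -> forall a b x,
  dual_lact D (amul D a b) x = dual_lact D a (dual_lact D b x).
Proof. by move=> [_ rD] a b x; apply: dual_ext => z /=; rewrite /bflip_fun /= rD. Qed.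

Lemma dual_ractM (A B : normedModType K) (D : bimod_data A B) :
  action_laws D -> forall x a b,
  dual_ract D x (amul D a b) = dual_ract D (dual_ract D x a) b.
Proof. by move=> [lD _] x a b; apply: dual_ext => z /=; rewrite lD. Qed.

End ArensLaws.

(** * Factorization from a unit in the bidual *)

Section FactorizationFromBidual.
Variables (R : realType) (s : scalars).
Let K := scalar_field R s.
Variables (A X : normedModType K) (m : bbilinear A A A) (L : bbilinear A X X).
Variable e : dual (dual A).
Hypothesis em : forall (f : dual A) a, e (badj m f a) = f a.
Hypothesis eL : forall (f : dual X) x, e (badj (bflip L) f x) = f x.

Lemma prod_norm_le (Y Z : normedModType K) (y : Y) (z : Z) (c : K) :
  (`|(y, z)| <= c) = (`|y| <= c) && (`|z| <= c).
Proof.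
rewrite prod_normE /=.
by rewrite comparable_ge_max ?real_comparable// ?normr_real.
Qed.

(** Both approximations have to hold for the same [u], which is why
    [weak_to_norm] is applied to the map [u |-> (a u, u x)] into the product
    [A * X]; a functional on the product is the sum of one on each factor. *)
Lemma bounded_approximation a x (eps : K) : 0 < eps ->
  exists u, [/\ `|u| <= `|e| + 1, `|m a u - a| <= eps & `|L u x - x| <= eps].
Proof.
move=> eps0; pose T u : (A * X)%type := (m a u, L u x).
have [||u [uM]] := @weak_to_norm R s A (A * X)%type T e (a, x) _ _ eps eps0.
- by move=> c u v; rewrite /T linearPr linearPl.
- move=> g h hT.
  have g1c : (fun u => g (u, 0)) \in @continuous_functional K A.
    apply: bounded_functional; last first.
      exists `|g| => u; rewrite (le_trans (ler_dual _ _))// ler_wpM2l//.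
      by rewrite prod_norm_le lexx normr0 normr_ge0.
    move=> c u v; rewrite -linearP; congr (g _).
    by congr pair; rewrite /= scaler0 addr0.
  have g2c : (fun v => g (0, v)) \in @continuous_functional K X.
    apply: bounded_functional; last first.
      exists `|g| => u; rewrite (le_trans (ler_dual _ _))// ler_wpM2l//.
      by rewrite prod_norm_le lexx normr0 normr_ge0.
    move=> c u v; rewrite -linearP; congr (g _).
    by congr pair; rewrite /= scaler0 addr0.
  have gE u v : g (u, v) = Dual g1c u + Dual g2c v.
    by rewrite /= -linearD; congr (g _); congr pair; rewrite ?addr0 ?add0r.
  have -> : h = badj m (Dual g1c) a + badj (bflip L) (Dual g2c) x.
    by apply: dual_ext => u; rewrite hT dualDE /T gE.
  by rewrite -[X in _ + X]scale1r dual_axpy mul1r em eL gE.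
rewrite /T prod_norm_le => /andP[ma Lx].
by exists u.
Qed.

Lemma bidual_unit_factorization :
  seq_complete A -> seq_complete X ->
  (forall a b x, L (m a b) x = L a (L b x)) ->
  forall x, exists a y, L a y = x.
Proof.
move=> Ac Xc LM; apply: (@cohen_factorization _ _ _ m L (`|e| + 1)) => //.
  by rewrite addr_ge0.
exact: bounded_approximation.
Qed.

End FactorizationFromBidual.

Section Bidual.
Variables (R : realType) (s : scalars).
Let K := scalar_field R s.

Lemma seq_complete_iter_dual (A : completeNormedModType K) k :
  seq_complete (iter_dual A k).
Proof.
case: k => [|k]; first exact: complete_seq_complete.
exact/seq_complete_dual/seq_complete_scalar_field.
Qed.

Variables (A B : normedModType K) (D : bimod_data A B).
Hypotheses (Ac : seq_complete A) (D_laws : action_laws D).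
Variable e : dual (dual A).

Let Bc : seq_complete (dual B).
Proof. exact/seq_complete_dual/seq_complete_scalar_field. Qed.

(** The condition on [e] in the algebra is [a e = a] evaluated at [f].  The one
    on the action compares [psi(b x)] with the Arens action of [b] on [psi],
    evaluated at [x]; they agree for [b] in [A], and continuity at [e] extends
    this to [e]. *)
Lemma lact_factorization : right_unit (arens_data D) e ->
  Zl D e = setT ->
  [set dual_lact D a b | a in [set: A] & b in [set: dual B]] = setT.
Proof.
move=> [ue uB] Ze; rewrite -subTset => x _.
have [|||a [y <-]] := @bidual_unit_factorization R s A (dual B) (amul D)
    (dual_lact D) e _ _ Ac Bc _ x; last by exists a => //; exists y.
- move=> f a; have /(congr1 (fun g => dual_fun g f)) := ue (canon_emb a).
  by [].
- move=> f b; have : Zl D e f by rewrite Ze.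
  move=> /weak_star_continuous_eval/(_ b) <-; first by rewrite uB.
  by move=> a /=; congr (dual_fun f _); exact: dual_ext.
- exact: dual_lactM.
Qed.

(** The previous argument for the opposite algebra.  Both conditions on [e] are
    the left unit identities evaluated at a functional, since the Arens
    extension of the left action applies [e] last. *)
Lemma ract_factorization : left_unit (arens_data D) e ->
  [set dual_ract D b a | b in [set: dual B] & a in [set: A]] = setT.
Proof.
move=> [ue uB]; rewrite -subTset => x _.
have [|||a [y <-]] := @bidual_unit_factorization R s A (dual B) (bflip (amul D))
    (bflip (dual_ract D)) e _ _ Ac Bc _ x; last by exists y => //; exists a.
- move=> f a; have /(congr1 (fun g => dual_fun g f)) := ue (canon_emb a).
  move=> /= <-; congr (dual_fun e _); exact: dual_ext.
- move=> f b; have /(congr1 (fun g => dual_fun g b)) := uB f.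
  move=> /= <-; congr (dual_fun e _); exact: dual_ext.
- by move=> a b y; exact: dual_ractM.
Qed.

Lemma lact_weak_star_dense : right_unit (arens_data D) e ->
  Zl_tilde D e = setT ->
  weak_star_closure [set dual_lact (arens_data D) (canon_emb a) b
    | a in [set: A] & b in [set: dual (dual (dual B))]] = setT.
Proof.
move=> [_ uB] Ze; rewrite -subTset => xi _.
apply: (@weak_star_closure_net _ A B e (fun b a => ract (arens_data D) b a)).
- exact: uB.
- by move=> b; have : Zl_tilde D e b by rewrite Ze.
- move=> a; exists (dual_lact (arens_data D) (canon_emb a) xi) => //.
  by exists a => //; exists xi.
Qed.

Lemma ract_weak_star_dense : left_unit (arens_data D) e ->
  Zr_tilde D e = setT ->
  weak_star_closure [set dual_ract (arens_data D) b (canon_emb a)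
    | b in [set: dual (dual (dual B))] & a in [set: A]] = setT.
Proof.
move=> [_ uB] Ze; rewrite -subTset => xi _.
apply: (@weak_star_closure_net _ A B e (fun b a => lact (arens_data D) a b)).
- exact: uB.
- by move=> b; have : Zr_tilde D e b by rewrite Ze.
- move=> a; exists (dual_ract (arens_data D) xi (canon_emb a)) => //.
  by exists xi => //; exists a.
Qed.

Lemma Zl_tilde_sub_Zl : Zl_tilde D e `<=` Zl D e.
Proof. by move=> b; exact: weak_star_weak. Qed.

End Bidual.

(** * The theorem *)

(* n = k + 2 *)
Theorem mainTheorem5 (R : realType) (s : scalars)
    (A B : completeNormedModType (scalar_field R s))
    (D0 : bimod_data A B) (D1 : bimod_data (dual A) (dual B))
    (hD0 : banach_bimodule D0) (hD1 : banach_bimodule D1) (k : nat) :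
  let D := bimod_tower D0 D1 in
  [/\ forall e : iter_dual A k.+2,
        right_unit (D k.+2) e -> Zl (D k) e = [set: iter_dual B k.+2] ->
        [set dual_lact (D k) a b | a in [set: iter_dual A k]
                                 & b in [set: iter_dual B k.+1]] = setT,
      forall e : iter_dual A k.+2,
        left_unit (D k.+2) e -> Zr (D k) e = [set: iter_dual B k.+2] ->
        [set dual_ract (D k) b a | b in [set: iter_dual B k.+1]
                                 & a in [set: iter_dual A k]] = setT,
      forall e : iter_dual A k.+2,
        right_unit (D k.+2) e -> Zl_tilde (D k) e = [set: iter_dual B k.+2] ->
        [set dual_lact (D k) a b | a in [set: iter_dual A k]
                                 & b in [set: iter_dual B k.+1]] = setT /\
        @weak_star_closure _ (iter_dual B k.+2)
          [set dual_lact (D k.+2) (canon_emb a) b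
            | a in [set: iter_dual A k] & b in [set: iter_dual B k.+3]] = setT
    & forall e : iter_dual A k.+2,
        left_unit (D k.+2) e -> Zr_tilde (D k) e = [set: iter_dual B k.+2] ->
        [set dual_ract (D k) b a | b in [set: iter_dual B k.+1]
                                 & a in [set: iter_dual A k]] = setT /\
        @weak_star_closure _ (iter_dual B k.+2)
          [set dual_ract (D k.+2) b (canon_emb a)
            | b in [set: iter_dual B k.+3] & a in [set: iter_dual A k]] = setT].
Proof.
move=> D; have laws : action_laws (D k).
  apply: tower_action_laws.
    by have [_ ? ? _] := hD0; split.
  by have [_ ? ? _] := hD1; split.
have Ac : seq_complete (iter_dual A k) := @seq_complete_iter_dual R s A k.
split=> e eu Ze.
- exact: (lact_factorization Ac laws eu Ze).
- exact: (ract_factorization Ac laws eu).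
- split; last exact: (lact_weak_star_dense eu Ze).
  apply: (lact_factorization Ac laws eu).
  by rewrite -subTset => b _; apply: Zl_tilde_sub_Zl; rewrite Ze.
- by split; [exact: (ract_factorization Ac laws eu)|
             exact: (ract_weak_star_dense eu Ze)].
Qed.
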